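(* For an odd prime $d$, there is no unit vector $g\in\mathbb{C}^d$ with $d<\mathrm{rank}(G(g))<2d$.
   Context: Vectors in $\mathbb{C}^d$ are indexed by $\mathbb{Z}_d$, $\omega=e^{2\pi i/d}$. The modulation and translation operators are $(Mg)_n=\omega^ng_n$ and $(Tg)_n=g_{n-1}$ (indices mod $d$). With $\Pi_{k,\ell}=(M^kT^\ell g)(M^kT^\ell g)^*$ for $(k,\ell)\in\mathbb{Z}_d\times\mathbb{Z}_d$, $G(g)$ is the $d^2\times d^2$ Gram matrix $(\mathrm{tr}(\Pi_{k,\ell}\Pi_{k',\ell'}^* ))_{(k,\ell),(k',\ell')}$. *)

(* Defs.v *)
From mathcomp Require Import all_boot all_order all_algebra.
From mathcomp Require Import reals trigo.
From mathcomp Require Import complex.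

Set Implicit Arguments.
Unset Strict Implicit.
Unset Printing Implicit Defensive.

Import GRing.Theory Num.Theory.
Local Open Scope ring_scope.
Local Open Scope complex_scope.
Local Open Scope sesquilinear_scope.

(* The complex numbers are R[i] for R : realType, and Z_d is represented by
   the ordinals 'I_d with arithmetic modulo d (rather than 'Z_d, whose
   cardinality is d only propositionally, for d > 1). *)

Definition omega (R : realType) (d : nat) : R[i] :=
  cos (2 * pi / d%:R) +i* sin (2 * pi / d%:R).

Definition l2norm (R : realType) (d : nat) (g : 'cV[R[i]]_d) : R[i] :=
  sqrtC (\sum_(n < d) `|g n 0| ^+ 2).

Definition modulation (R : realType) (d : nat) (g : 'cV[R[i]]_d) :
    'cV[R[i]]_d :=
  \col_(n < d) (omega R d ^+ n * g n 0).

(* ord_pred n is n - 1 modulo d. *)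
Definition translation (R : realType) (d : nat) (g : 'cV[R[i]]_d) :
    'cV[R[i]]_d :=
  \col_(n < d) g (ord_pred n) 0.

Definition weyl_heisenberg (R : realType) (d : nat) (g : 'cV[R[i]]_d)
    (k l : 'I_d) : 'cV[R[i]]_d :=
  iter k (@modulation R d) (iter l (@translation R d) g).

(* M ^t* is the conjugate transpose of M. *)
Definition Pi (R : realType) (d : nat) (g : 'cV[R[i]]_d)
    (kl : 'I_d * 'I_d) : 'M[R[i]]_d :=
  weyl_heisenberg g kl.1 kl.2 *m (weyl_heisenberg g kl.1 kl.2)^t*.

(* Rows and columns are indexed by Z_d x Z_d, through the standard enumeration
   of this d^2-element type. *)
Definition gram (R : realType) (d : nat) (g : 'cV[R[i]]_d) :
    'M[R[i]]_#|{: 'I_d * 'I_d}| :=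
  \matrix_(a, b) \tr (Pi g (enum_val a) *m (Pi g (enum_val b))^t*).

(* Main.v *)
Require Import Defs.
From mathcomp Require Import all_boot all_order all_algebra.
From mathcomp Require Import reals trigo.
From mathcomp Require Import complex.
From mathcomp Require Import ring zify.

Import Order.TTheory GRing.Theory Num.Theory.

(** Write W(k,l) = M^k T^l and A(k,l) = <g, W(k,l) g>, the ambiguity function
    of g, a function on the plane Z_d x Z_d.

    The Gram matrix has entries |A(mu - lambda)|^2, so that the characters of
    the plane diagonalize it and its eigenvalues are the Fourier coefficients
    of |A|^2.  Up to a factor d, |A|^2 is its own symplectic Fourier transform
    ([fourier_norm_amb]); hence the rank of the Gram matrix is the cardinality
    N of the support of A ([rank_gram]), and the claim is that d < N < 2d is
    impossible ([support_gap]).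

    Suppose N < 2d.  The support is symmetric under negation, and the d lines
    {(a t, t) : t in Z_d} meet only at the origin.  Were each of them to meet
    the support away from the origin, it would do so in two opposite points,
    and N would be at least 2d ([card_support_lines]).  So A vanishes on some
    line, except at the origin.  Then the d vectors W(a t, t) g form an
    orthonormal basis.  For s != 0, the coefficients of W(s, 0) g in it are, up
    to phases, the values b_t = A(s + a t, t) of A on a coset of the line, and
    the orthogonality of W(s, 0) g to its own translates along the line is a
    twisted autocorrelation identity ([coset_autocorrelation]):
      sum_t chi(- a r t) b_t^* b_(t+r) = [r = 0].
    It restricts how many of the b_t are nonzero:
    - not zero of them, by the identity for r = 0;
    - not exactly two, at i and j: for r = i - j, the sum has a single nonzero
      term, because d is odd;
    - if exactly one, then it has modulus 1, so that g is an eigenvector of a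
      nontrivial W(k, l).  Then A vanishes off the line through (k, l), by the
      commutation relations, and N <= d ([card_support_eigen]).
    So if d < N, each of the d - 1 nontrivial cosets contains at least three
    points of the support, and N >= 3 (d - 1) >= 2 d. *)

(** * Rank of a diagonal matrix *)

Section RankDiag.
Local Open Scope ring_scope.
Variables (F : fieldType) (n : nat).

Lemma rank_diag_le (v : 'rV[F]_n) :
  (\rank (diag_mx v) <= \sum_i (v ord0 i != 0%R))%N.
Proof.
rewrite diag_mx_sum_delta.
elim/big_rec2: _ => [|i r M _ leMr]; first by rewrite mxrank0.
apply: leq_trans (mxrank_add _ _) (leq_add _ leMr).
have [->|_] := eqVneq (v _ i) 0; first by rewrite scale0r mxrank0.
apply: leq_trans (mxrankS (scalemx_sub _ (submx_refl _))) _.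
by rewrite mxrank_delta.
Qed.

(** Completing the zero entries by ones gives an invertible matrix, so the upper
    bound on the rank of the completing part is a lower bound on that of [v]. *)
Lemma rank_diag (v : 'rV[F]_n) :
  \rank (diag_mx v) = (\sum_i (v ord0 i != 0%R))%N.
Proof.
apply/eqP; rewrite eqn_leq rank_diag_le /=.
pose w : 'rV[F]_n := \row_i (v ord0 i == 0)%:R.
have full : \rank (diag_mx v + diag_mx w)%R = n.
  have -> : diag_mx v + diag_mx w = diag_mx (v + w).
    by apply/matrixP => i j; rewrite !mxE mulrnDl.
  apply: mxrank_unit; rewrite unitmxE det_diag unitfE.
  apply/prodf_neq0 => i _; rewrite !mxE.
  by have [->|vi] := eqVneq (v ord0 i) 0; rewrite ?add0r ?oner_eq0 ?addr0.
have split_n : (\sum_i (v ord0 i != 0%R) + \sum_i (w ord0 i != 0%R) = n)%N.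
  rewrite -big_split /= -[RHS]card_ord -sum1_card; apply: eq_bigr => i _.
  by rewrite mxE; case: eqVneq => _; rewrite ?oner_eq0 ?eqxx.
have := mxrank_add (diag_mx v) (diag_mx w).
rewrite full -{1}split_n => /leq_trans/(_ (leq_add (leqnn _) (rank_diag_le w))).
by rewrite leq_add2r.
Qed.
End RankDiag.

(** * Characters of Z_d *)

Section WeylHeisenberg.
Set Implicit Arguments.
Unset Strict Implicit.
Unset Printing Implicit Defensive.
Local Open Scope ring_scope.

Variables (C : numClosedFieldType) (p : nat) (z : C).
Hypothesis zP : p.+2.-primitive_root z.
Hypothesis p_prime : prime p.+2.

Local Notation Zd := 'I_p.+2.

Lemma Zd_unit (x : Zd) : (x \is a GRing.unit) = (x != 0).
Proof.
rewrite -[x in LHS]natr_Zp (@unitZpE p.+2) // prime_coprime //.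
rewrite -(inj_eq val_inj) /=; apply/idP/idP.
  by apply: contra => /eqP ->; rewrite dvdn0.
by move=> x0; rewrite gtnNdvd // lt0n.
Qed.

Lemma Zd_mulI (x : Zd) : x != 0 -> injective ( *%R x).
Proof. by move=> x0; apply: mulrI; rewrite Zd_unit. Qed.

Lemma Zd_mul_eq0 (x y : Zd) : x != 0 -> (x * y == 0) = (y == 0).
Proof. by move=> x0; rewrite -[X in _ == X](mulr0 x) (inj_eq (Zd_mulI x0)). Qed.

Definition chi (x : Zd) : C := z ^+ x.

Lemma chi_nat n : chi n%:R = z ^+ n.
Proof. by rewrite /chi Zp_nat /= (prim_expr_mod zP). Qed.

Lemma chi0 : chi 0 = 1.
Proof. by []. Qed.

Lemma chiD x y : chi (x + y) = chi x * chi y.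
Proof. by rewrite -[x]natr_Zp -[y]natr_Zp -natrD !chi_nat exprD. Qed.

Lemma chiNK x : chi (- x) * chi x = 1.
Proof. by rewrite -chiD addNr. Qed.

Lemma chi_neq0 x : chi x != 0.
Proof. by apply/eqP => E; have:= oner_neq0 C; rewrite -(chiNK x) E mulr0 eqxx. Qed.

Lemma norm_chi x : `|chi x| = 1.
Proof.
have /eqP z1 : `|z| == 1.
  by rewrite -(@pexpr_eq1 _ _ p.+2) // -normrX (prim_expr_order zP) normr1.
by rewrite /chi normrX z1 expr1n.
Qed.

Lemma conj_chi x : (chi x)^* = chi (- x).
Proof.
by apply: (mulIf (chi_neq0 x)); rewrite chiNK -normCKC norm_chi expr1n.
Qed.

Lemma chi_eq1 x : (chi x == 1) = (x == 0).
Proof.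
by rewrite /chi -(prim_order_dvd zP) -[RHS](inj_eq val_inj) /= /dvdn modn_small.
Qed.

Lemma sum_chi (y : Zd) : \sum_(x : Zd) chi (x * y) = p.+2%:R *+ (y == 0).
Proof.
have [->|y0] := eqVneq y 0.
  under eq_bigr do rewrite mulr0 chi0.
  by rewrite sumr_const card_ord.
set s := \sum_x _.
have: chi y * s = s.
  rewrite /s mulr_sumr [RHS](reindex_inj (addrI 1)) /=.
  by apply: eq_bigr => x _; rewrite -chiD mulrDl mul1r.
move/eqP; rewrite -subr_eq0 -[X in _ - X]mul1r -mulrBl mulf_eq0 subr_eq0 chi_eq1.
by rewrite (negPf y0) => /eqP.
Qed.

Lemma sum_chi2 (x y : Zd) :
  \sum_k \sum_l chi (l * x - k * y) = p.+2%:R ^+ 2 *+ ((x == 0) && (y == 0)).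
Proof.
transitivity (\sum_k \sum_l chi (l * x) * chi (k * - y)).
  by do 2![apply: eq_bigr => ? _]; rewrite -chiD mulrN.
rewrite exchange_big -big_distrlr /= !sum_chi oppr_eq0.
by do 2!case: eqP; rewrite ?mulr0 ?mul0r ?expr2.
Qed.

(** * The Weyl-Heisenberg operators and the ambiguity function *)

(** The operator M^k T^l, on functions rather than column vectors. *)
Definition wh (k l : Zd) (f : Zd -> C) : Zd -> C :=
  fun n => chi (k * n) * f (n - l).

Definition dot (f h : Zd -> C) : C := \sum_n (f n)^* * h n.

Lemma eq_dot f1 f2 h1 h2 : f1 =1 f2 -> h1 =1 h2 -> dot f1 h1 = dot f2 h2.
Proof. by move=> Ef Eh; apply: eq_bigr => n _; rewrite Ef Eh. Qed.

Lemma dotZr c f h : dot f (fun n => c * h n) = c * dot f h.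
Proof. by rewrite mulr_sumr; apply: eq_bigr => n _; ring. Qed.

Lemma dotZl c f h : dot (fun n => c * f n) h = c^* * dot f h.
Proof. by rewrite mulr_sumr; apply: eq_bigr => n _; rewrite rmorphM; ring. Qed.

Lemma conj_dot f h : (dot f h)^* = dot h f.
Proof.
rewrite rmorph_sum; apply: eq_bigr => n _.
by rewrite rmorphM /= conjCK mulrC.
Qed.

Lemma whM k l k' l' f :
  wh k l (wh k' l' f) =1 (fun n => chi (- (k' * l)) * wh (k + k') (l + l') f n).
Proof.
move=> n; rewrite /wh !mulrA -!chiD opprD addrA.
by congr (chi _ * _); ring.
Qed.

(** Unitarity and the commutation relations together: up to a phase, an inner
    product of two translates depends only on the difference of their indices. *)
Lemma dot_wh k l k' l' f h :
  dot (wh k l f) (wh k' l' h) =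
  chi ((k' - k) * l) * dot f (wh (k' - k) (l' - l) h).
Proof.
rewrite mulr_sumr [LHS](reindex_inj (addIr l)) /=; apply: eq_bigr => n _.
rewrite /wh addrK rmorphM /= conj_chi.
rewrite mulrACA -chiD [X in _ = _ * X]mulrCA [RHS]mulrA -chiD.
by congr (chi _ * (_ * h _)); ring.
Qed.

Section Ambiguity.
Variable g : Zd -> C.

Definition amb k l := dot g (wh k l g).

Definition amb_support := [set kl : Zd * Zd | amb kl.1 kl.2 != 0].

Lemma amb0 : amb 0 0 = dot g g.
Proof. by apply: eq_dot => // n; rewrite /wh mul0r mul1r subr0. Qed.

Lemma ambN k l : amb (- k) (- l) = chi (k * l) * (amb k l)^*.
Proof.
have E : dot (wh k l g) g = dot (wh k l g) (wh 0 0 g).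
  by apply: eq_dot => // n; rewrite /wh mul0r mul1r subr0.
by rewrite /amb conj_dot E dot_wh !sub0r mulNr mulrA -chiD addrN mul1r.
Qed.

(** The equality case of the Cauchy-Schwarz inequality for [g] and [wh k l g]. *)
Lemma wh_eigenvector k l :
  dot g g = 1 -> `|amb k l| = 1 -> wh k l g =1 (fun n => amb k l * g n).
Proof.
move=> g1 + n; set b := amb k l => b1; set w := wh k l g.
have w1 : dot w w = 1.
  by rewrite dot_wh !subrr mul0r mul1r -/(amb 0 0) amb0.
have gw : dot g w = b by [].
have wg : dot w g = b^* by rewrite -gw conj_dot.
clearbody b w.
have: \sum_m `|w m - b * g m| ^+ 2 = 0.
  transitivity (dot w w - b * dot w g - b^* * dot g w + b * b^* * dot g g).
    rewrite /dot !mulr_sumr -!sumrB -big_split /=.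
    by apply: eq_bigr => m _; rewrite normCKC rmorphB rmorphM /=; ring.
  by rewrite g1 w1 gw wg -normCKC -normCK b1; ring.
move/eqP; rewrite psumr_eq0 => [|m _]; last exact: exprn_ge0.
move/allP/(_ n); rewrite mem_index_enum => /(_ isT) /=.
by rewrite expf_eq0 normr_eq0 subr_eq0 => /eqP.
Qed.

(** If [g] is an eigenvector of [wh k l], then [wh k' l'] may be conjugated by
    [wh k l] inside [amb k' l']: this multiplies it by [chi (k' * l - k * l')],
    which must be 1 where [amb] does not vanish. *)
Lemma amb_symplectic k l k' l' :
  dot g g = 1 -> `|amb k l| = 1 -> amb k' l' != 0 -> k' * l = k * l'.
Proof.
move=> g1 b1 nz; have := wh_eigenvector g1 b1.
move: (amb k l) b1 => b b1 Eg.
have: dot (wh k l g) (wh k' l' (wh k l g)) = amb k' l'.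
  transitivity (dot (fun n => b * g n) (fun n => b * wh k' l' g n)).
    apply: eq_dot => n; first exact: Eg.
    by rewrite [RHS]mulrCA -Eg.
  by rewrite dotZl dotZr mulrA -normCKC b1 expr1n mul1r.
rewrite (eq_dot (frefl _) (whM _ _ _ _ _)) dotZr dot_wh !addrK mulrA -chiD.
move/eqP; rewrite -subr_eq0 -[X in _ - X]mul1r -mulrBl mulf_eq0 (negPf nz) orbF.
by rewrite subr_eq0 chi_eq1 addrC subr_eq0 => /eqP.
Qed.

(** * The rank of the Gram matrix is the size of the support *)

(** Self-duality of the squared modulus of the ambiguity function.  It holds
    because the sum over [k] turns the four-fold product of values of [g] into
    [(g (m + l0))^* * g (m + l0 - l) * g m * (g (m - l))^*], which is
    of the form [x m * (x (m - l))^*] for [x m = (g (m + l0))^* * g m]: the sum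
    over [l] and [m] factors as a squared modulus. *)
Lemma fourier_norm_amb q l0 :
  \sum_k \sum_l chi (l * q - k * l0) * `|amb k l| ^+ 2 =
  p.+2%:R * `|amb q l0| ^+ 2.
Proof.
pose F m n l := chi (l * q) * ((g n)^* * g (n - l) * g m * (g (m - l))^*).
transitivity (\sum_l \sum_n \sum_m p.+2%:R * (F m n l *+ (n - m - l0 == 0))).
  rewrite exchange_big /=; apply: eq_bigr => l _.
  under eq_bigr => k _.
    rewrite normCK {2}/amb conj_dot /amb /dot mulr_suml mulr_sumr.
    under eq_bigr => n _ do rewrite mulr_sumr mulr_sumr.
    over.
  rewrite exchange_big /=; apply: eq_bigr => n _.
  rewrite exchange_big /=; apply: eq_bigr => m _.
  transitivity (\sum_k chi (k * (n - m - l0)) * F m n l).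
    apply: eq_bigr => k _; rewrite /F /wh rmorphM /= conj_chi.
    rewrite !mulrBr !chiD; ring.
  by rewrite -mulr_suml sum_chi; case: eqP => _; rewrite ?mul0r ?mulr0.
transitivity (\sum_l \sum_m p.+2%:R * F m (m + l0) l).
  apply: eq_bigr => l _; rewrite exchange_big /=; apply: eq_bigr => m _.
  rewrite (bigD1 (m + l0)) //= big1 ?addr0 => [|n nm].
    by rewrite [m + l0]addrC addrK subrr eqxx.
  by rewrite -addrA -opprD subr_eq0 (negPf nm) mulr0.
rewrite exchange_big /=.
have conv : amb q l0 =
    chi (q * l0) * \sum_m chi (q * m) * ((g (m + l0))^* * g m).
  rewrite mulr_sumr /amb /dot [LHS](reindex_inj (addIr l0)) /=.
  by apply: eq_bigr => m _; rewrite /wh addrK mulrDr chiD; ring.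
rewrite normCK conv rmorphM rmorph_sum /= conj_chi mulrACA.
rewrite [chi _ * _]mulrC chiNK mul1r.
rewrite mulr_suml mulr_sumr; apply: eq_bigr => m _.
(* The summation variable l becomes j = m - l, which separates m and j. *)
rewrite [LHS](reindex_inj (can_inj (subKr m))) /= mulr_sumr mulr_sumr.
apply: eq_bigr => j _; rewrite /F subKr addrAC subKr.
have -> : chi ((m - j) * q) = chi (q * m) * chi (- (q * j)).
  by rewrite -chiD; congr chi; ring.
by rewrite !rmorphM /= conj_chi conjCK [j + l0]addrC; ring.
Qed.

(** Such a matrix is diagonalized by the characters of the plane, here indexed
    through the symplectic form.  By self-duality, its eigenvalues are [p.+2]
    times the values of the squared modulus of [amb]. *)
Lemma rank_amb_difference_matrix :
  \rank (\matrix_(a < #|{: Zd * Zd}|, b < #|{: Zd * Zd}|)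
           `|amb ((enum_val b).1 - (enum_val a).1)
                 ((enum_val b).2 - (enum_val a).2)| ^+ 2) = #|amb_support|.
Proof.
pose form (x y : Zd * Zd) := x.2 * y.1 - x.1 * y.2.
pose F := \matrix_(a < #|{: Zd * Zd}|, m < #|{: Zd * Zd}|)
  chi (- form (enum_val m) (enum_val a)).
pose F' := \matrix_(m < #|{: Zd * Zd}|, b < #|{: Zd * Zd}|)
  (p.+2%:R ^- 2 * chi (form (enum_val m) (enum_val b))).
pose v := \row_(m < #|{: Zd * Zd}|)
  (p.+2%:R * `|amb (enum_val m).1 (enum_val m).2| ^+ 2).
have d_neq0 : p.+2%:R != 0 :> C by rewrite pnatr_eq0.
have formB x y w : - form x y + form x w =
    x.2 * (w.1 - y.1) - x.1 * (w.2 - y.2) by rewrite /form; ring.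
have FF' : F *m F' = 1%:M.
  apply/matrixP => a b; rewrite !mxE.
  under eq_bigr do rewrite !mxE mulrCA -chiD formB.
  rewrite -mulr_sumr.
  rewrite -(big_enum_val (fun m : Zd * Zd =>
    chi (m.2 * ((enum_val b).1 - (enum_val a).1)
         - m.1 * ((enum_val b).2 - (enum_val a).2)))) /=.
  set q := _ - _; set l0 := (_ - (enum_val a).2).
  rewrite -(pair_bigA _ (fun k l => chi (l * q - k * l0))) /=.
  rewrite sum_chi2 /q /l0 !subr_eq0 -xpair_eqE -!surjective_pairing.
  rewrite (inj_eq enum_val_inj) eq_sym.
  by case: (a == b); rewrite ?mulr0 // mulVf // expf_neq0.
have [F_unit F'_unit] := mulmx1_unit FF'.
transitivity (\rank (F *m diag_mx v *m F')).
  congr (\rank _); apply/matrixP => a b; rewrite !mxE.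
  apply: (mulfI d_neq0); rewrite -fourier_norm_amb.
  set q := _ - _; set l0 := (_ - (enum_val a).2).
  pose T x := chi (x.2 * q - x.1 * l0) * `|amb x.1 x.2| ^+ 2.
  rewrite (pair_bigA _ (fun k l => T (k, l))) /=.
  transitivity (\sum_(x in {: Zd * Zd}) T x); first by apply: eq_bigr => -[].
  rewrite big_enum_val mulr_sumr; apply: eq_bigr => m _.
  rewrite mul_mx_diag !mxE /T -formB chiD.
  by move: (p.+2%:R) d_neq0 => D D_neq0; field.
rewrite mxrankMfree ?row_free_unit // (eqmxMfull _ _) ?row_full_unit //.
rewrite rank_diag -[RHS]sum1_card [RHS]big_mkcond /=.
transitivity (\sum_(x in {: Zd * Zd}) (amb x.1 x.2 != 0%R))%N.
  rewrite [RHS]big_enum_val; apply: eq_bigr => m _.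
  by rewrite mxE mulf_eq0 (negPf d_neq0) expf_eq0 normr_eq0.
by apply: eq_bigr => x _; rewrite inE; case: eqP.
Qed.

(** * Consequences of an empty line *)

Section EmptyLine.
Variable a : Zd.
Hypothesis g1 : dot g g = 1.
Hypothesis line0 : forall t : Zd, t != 0 -> amb (a * t) t = 0.

Let e (t : Zd) := wh (a * t) t g.

Lemma line_orthonormal (s t : Zd) : dot (e s) (e t) = (s == t)%:R.
Proof.
rewrite /e dot_wh -mulrBr -/(amb _ _); have [->|st] := eqVneq s t.
  by rewrite subrr !(mulr0, mul0r) chi0 amb0 g1 mul1r.
by rewrite line0 ?mulr0 // subr_eq0 eq_sym.
Qed.

Lemma line_parseval f h : dot f h = \sum_t dot f (e t) * dot (e t) h.
Proof.
pose E := \matrix_(t, n) e t n; pose E' := \matrix_(n, t) (e t n)^*.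
have: E *m E' = 1%:M.
  apply/matrixP => s t; rewrite !mxE eq_sym -line_orthonormal /dot.
  by apply: eq_bigr => n _; rewrite !mxE mulrC.
move/mulmx1C => E'E.
have H n m : \sum_t (e t n)^* * e t m = (n == m)%:R.
  move/matrixP/(_ n m): E'E; rewrite !mxE => <-.
  by apply: eq_bigr => t _; rewrite !mxE.
transitivity (\sum_t \sum_n \sum_m (f m)^* * h n * ((e t n)^* * e t m)).
  rewrite exchange_big /=; apply: eq_bigr => n _.
  rewrite exchange_big /= (bigD1 n) //= -mulr_sumr H eqxx mulr1.
  rewrite big1 ?addr0 // => m nm.
  by rewrite -mulr_sumr H eq_sym (negPf nm) mulr0.
apply: eq_bigr => t _; rewrite mulrC /dot mulr_suml.
apply: eq_bigr => n _; rewrite mulr_sumr.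
by apply: eq_bigr => m _; ring.
Qed.

(** Up to a phase depending only on [s] and [r], both sides are the inner product
    of [wh s 0 g] with its image under [wh (a * r) r]: the left side computes it
    in the basis [e], the right side by moving it to the empty line. *)
Lemma coset_autocorrelation (s r : Zd) :
  \sum_t chi (- (a * r * t)) * (amb (s + a * t) t)^*
           * amb (s + a * (t + r)) (t + r) = (r == 0)%:R.
Proof.
transitivity (dot (wh s 0 g) (wh (a * r + s) r g)).
  rewrite line_parseval [RHS](reindex_inj oppr_inj) /=; apply: eq_bigr => t _.
  have coef k l : dot (e (- t)) (wh k l g) =
      chi (- ((k + a * t) * t)) * amb (k + a * t) (l + t).
    by rewrite /e dot_wh !mulrN !opprK.
  rewrite -conj_dot !coef rmorphM /= conj_chi add0r mulrACA -chiD mulrA.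
  have -> : a * r + s + a * t = s + a * (t + r) by ring.
  by rewrite [r + t]addrC; congr (chi _ * _ * _); ring.
rewrite dot_wh mulr0 addrK subr0 -/(amb _ _) chi0 mul1r.
by have [->|r0] := eqVneq r 0; rewrite ?mulr0 ?amb0 // line0.
Qed.
End EmptyLine.

End Ambiguity.

(** * Counting the support *)

Hypothesis d_odd : odd p.+2.

Lemma Zd_double_eq0 (x : Zd) : (x + x == 0) = (x == 0).
Proof.
have two_neq0 : (2%:R : Zd) != 0.
  by rewrite -(inj_eq val_inj) Zp_nat /=; case: p d_odd.
by rewrite -mulr2n -mulr_natl Zd_mul_eq0.
Qed.

Section Support.
Variable g : Zd -> C.
Hypothesis g1 : dot g g = 1.

Let supp := amb_support g.

(** The support on the coset of the line {(a t, t)} through (s, 0), parametrized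
    by t. *)
Definition coset_part (a s : Zd) := [set t | amb g (s + a * t) t != 0].

(** A point of the support on each of the [p.+2] lines, and the opposites of
    these points. *)
Lemma card_support_lines :
  (forall a : Zd, exists2 t, t != 0 & amb g (a * t) t != 0) ->
  (2 * p.+2 <= #|supp|)%N.
Proof.
move=> hit.
have [t t_neq0 t_hit] := fin_all_exists2 hit.
pose x (ab : Zd * bool) := if ab.2 then t ab.1 else - t ab.1.
pose h ab := (ab.1 * x ab, x ab).
have x_neq0 ab : x ab != 0 by rewrite /x; case: ab.2; rewrite ?oppr_eq0.
have h_inj : injective h.
  move=> ab ab' E; have Ex : x ab = x ab' := congr1 snd E.
  have: ab.1 * x ab = ab'.1 * x ab' := congr1 fst E.
  rewrite -Ex ![_ * x ab]mulrC => /(Zd_mulI (x_neq0 ab)).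
  case: ab ab' Ex E => a b [a' b'] + _ /= Ea.
  rewrite -{a'}Ea /x /=; case: b b' => [] [] // /eqP.
    by rewrite -addr_eq0 Zd_double_eq0 (negPf (t_neq0 a)).
  by rewrite eq_sym -addr_eq0 Zd_double_eq0 (negPf (t_neq0 a)).
have -> : (2 * p.+2)%N = #|[set h ab | ab in [set: Zd * bool]]|.
  by rewrite card_imset // cardsT card_prod card_bool card_ord mulnC.
apply/subset_leq_card/subsetP => _ /imsetP[[a b] _ ->]; rewrite inE /h /x /=.
case: b => //=; rewrite mulrN ambN mulf_neq0 ?chi_neq0 //.
by rewrite conjC_eq0.
Qed.

(** The support lies on the line through the nonzero point [(k, l)], and one of
    the two coordinates is injective on that line. *)
Lemma card_support_eigen k l :
  `|amb g k l| = 1 -> (k, l) != (0, 0) -> (#|supp| <= p.+2)%N.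
Proof.
move=> b1 kl0; pose f (x : Zd * Zd) := if l == 0 then x.1 else x.2.
have f_inj : {in supp &, injective f}.
  move=> [k1 l1] [k2 l2]; rewrite !inE /= /f.
  move=> /(amb_symplectic g1 b1) E1 /(amb_symplectic g1 b1) E2.
  have [l0|l_neq0] := eqVneq l 0 => /= E.
    have k0 : k != 0 by apply: contraNneq kl0 => ->; rewrite l0.
    rewrite E in E1 *; congr (_, _); apply: (Zd_mulI k0).
    by rewrite -E1 -E2.
  rewrite E in E1 *; congr (_, _); apply: (Zd_mulI l_neq0).
  by rewrite mulrC E1 -E2 mulrC.
by rewrite -(card_in_imset f_inj) (leq_trans (max_card _)) ?card_ord.
Qed.

(** The autocorrelation identity excludes a coset with no point or with two, and a
    coset with a single point makes the whole support small. *)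
Lemma coset_support (a s : Zd) :
  (forall t : Zd, t != 0 -> amb g (a * t) t = 0) -> s != 0 ->
  (p.+2 < #|supp|)%N ->
  (2 < #|coset_part a s|)%N.
Proof.
move=> line0 s0 large; set B := coset_part a s.
have autocor := coset_autocorrelation g1 line0 s.
have B0 t : t \notin B -> amb g (s + a * t) t = 0 by rewrite inE negbK => /eqP.
rewrite ltnNge; apply/negP => B_le2.
have: (#|B| == 0) || (#|B| == 1) || (#|B| == 2).
  by case: #|B| B_le2 => [|[|[]]].
case/orP => [/orP[]|].
- rewrite cards_eq0 => /eqP BE; have := autocor 0; rewrite big1 => [|t _].
    by move/esym/eqP; rewrite oner_eq0.
  by rewrite addr0 B0 ?mulr0 // BE inE.
- case/cards1P => i BE; move: large; apply/negP; rewrite -leqNgt.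
  apply: (@card_support_eigen (s + a * i) i).
    have := autocor 0; rewrite (bigD1 i) //= big1 => [|t ti]; last first.
      by rewrite addr0 B0 ?mulr0 // BE inE.
    rewrite mulr0 mul0r oppr0 chi0 mul1r !addr0 -normCKC => /eqP.
    by rewrite sqrp_eq1 // => /eqP.
  by apply: contraNneq s0 => /eqP; rewrite xpair_eqE => /andP[] /[swap] /eqP->;
    rewrite mulr0 addr0.
case/cards2P => i [j [ij BE]]; have := autocor (i - j).
(* The term t = j pairs j with i.  The term t = i would pair i with 2 i - j,
   which is neither i nor, as 2 is invertible, j. *)
have nz t : t \in B -> amb g (s + a * t) t != 0 by rewrite inE.
rewrite (bigD1 j) //= big1 => [|t tj].
  rewrite addr0 subr_eq0 (negPf ij) (addrC j) subrK => /eqP; apply/negP.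
  by rewrite !mulf_neq0 ?chi_neq0 ?conjC_eq0 ?nz ?BE ?inE ?eqxx ?orbT.
have [->|ti] := eqVneq t i; last first.
  by rewrite (B0 t) ?conjC0 ?mulr0 ?mul0r // BE !inE (negPf ti) (negPf tj).
rewrite [X in _ * X]B0 ?mulr0 // BE !inE negb_or; apply/andP; split.
  by rewrite -[X in _ != X]addr0 (inj_eq (addrI i)) subr_eq0.
rewrite -subr_eq0 (_ : _ - j = (i - j) + (i - j)); last by ring.
by rewrite Zd_double_eq0 subr_eq0.
Qed.

Lemma card_support_cosets (a : Zd) :
  #|supp| = (\sum_s #|coset_part a s|)%N.
Proof.
rewrite -sum1_card big_mkcond /=.
pose h (x : Zd * Zd) := (x.1 + a * x.2, x.2).
have h_inj : injective h.
  move=> [s t] [s' t'] E; have Et : t = t' := congr1 snd E.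
  by move: (congr1 fst E); rewrite /= Et => /addIr ->.
rewrite (reindex_inj h_inj) /=.
rewrite -(pair_bigA _ (fun s t => if h (s, t) \in supp then 1 else 0)%N) /=.
apply: eq_bigr => s _; rewrite -sum1_card [RHS]big_mkcond /=.
by apply: eq_bigr => t _; rewrite !inE.
Qed.

Lemma support_gap : ~ (p.+2 < #|supp| < 2 * p.+2)%N.
Proof.
case/andP => large small.
have /existsP[a /forall_inP line0] :
    [exists a, forall (t | t != 0), amb g (a * t) t == 0].
  apply/contraT => /existsPn none; move: small; rewrite ltnNge => /negP[].
  apply: card_support_lines => a; have /forall_inPn[t t0 nz] := none a.
  by exists t.
move: small; rewrite (card_support_cosets a) ltnNge => /negP; apply.
rewrite (bigD1 0) //=; apply: leq_trans (leq_addl _ _).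
have three s : s != 0 -> (3 <= #|coset_part a s|)%N.
  by move=> s0; apply: coset_support => // t /line0/eqP.
apply: leq_trans (leq_sum _ three).
rewrite sum_nat_const.
have -> : #|[pred s : Zd | s != 0]| = p.+1.
  by have := cardC1 (0 : Zd); rewrite card_ord.
by case: p d_odd => // q _; lia.
Qed.
End Support.

End WeylHeisenberg.

(** * The root of unity and the Gram matrix *)

Lemma omegaX (R : realType) (d n : nat) (t := (2 * pi / d%:R : R)%R) :
  (omega R d ^+ n = Complex (cos (t *+ n)) (sin (t *+ n)))%R.
Proof.
elim: n => [|n IHn]; first by rewrite expr0 mulr0n cos0 sin0.
rewrite exprS IHn mulrS cosD sinD /omega -/t; apply/eqP; rewrite eq_complex /=.
by rewrite eqxx addrC eqxx.
Qed.

(** The order of [omega R d] divides the prime [d]; it is not 1 because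
    [2 * pi / d] lies strictly between 0 and [pi], where the sine is positive. *)
Lemma omega_primitive (R : realType) (d : nat) :
  prime d -> odd d -> (d.-primitive_root (omega R d))%R.
Proof.
move=> d_prime d_odd; have d_gt2 : (2 < d)%N by rewrite odd_prime_gt2.
have d_neq0 : (d%:R != 0 :> R)%R by rewrite pnatr_eq0 -lt0n ltnW // ltnW.
have wd : (omega R d ^+ d = 1)%R.
  rewrite omegaX -[(_ / _ *+ _)%R]mulr_natr divfK // mulr_natl.
  by rewrite -[(pi *+ 2)%R]add0r cosD2pi sinD2pi cos0 sin0.
have [m m_prim /(primeP d_prime).2] := prim_order_exists (prime_gt0 d_prime) wd.
case/orP=> /eqP md; last by rewrite -md in m_prim *.
have := prim_expr_order m_prim; rewrite md expr1 => /(congr1 (@complex.Im R)) /=.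
move=> /eqP; rewrite gt_eqF //; apply: sin_gt0_pi.
have d_gt0 : (0 < d%:R :> R)%R by rewrite ltr0n prime_gt0.
rewrite divr_gt0 ?mulr_gt0 ?pi_gt0 //= ltr_pdivrMr // mulrC ltr_pM2l ?pi_gt0 //.
by rewrite ltr_nat.
Qed.

Section GramMatrix.
Local Open Scope ring_scope.
Variables (R : realType) (p : nat).
Hypothesis d_prime : prime p.+2.
Hypothesis d_odd : odd p.+2.
Variable g : 'cV[R[i]]_p.+2.

Let w : R[i] := omega R p.+2.
Let w_prim : p.+2.-primitive_root w := omega_primitive R d_prime d_odd.
Let f (n : 'I_p.+2) : R[i] := g n ord0.

Lemma weyl_heisenbergE (k l n : 'I_p.+2) :
  weyl_heisenberg g k l n ord0 = wh w k l f n.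
Proof.
have translE m j : iter m (@translation R p.+2) g j ord0 = f (j - m%:R).
  elim: m j => [|m IHm] j; first by rewrite subr0.
  rewrite iterS mxE IHm mulrS opprD addrA; congr (f (_ - _)).
  by apply: val_inj; rewrite /= [(1 %% _)%N]modn_small // subn1 modnDmr addnS.
rewrite /weyl_heisenberg /wh -[X in f (n - X)]natr_Zp -translE.
have -> : chi w (k * n) = w ^+ (n * k).
  by rewrite -(chi_nat w_prim) natrM !natr_Zp mulrC.
rewrite exprM; move: (iter l _ _) => h.
elim: (k : nat) => [|m IHm]; first by rewrite mul1r.
by rewrite iterS mxE IHm mulrA -exprS.
Qed.

(** The trace of the product of two rank one projections is the squared modulus
    of an inner product. *)
Lemma gramE : gram g =
  \matrix_(a, b) `|amb w f ((enum_val b).1 - (enum_val a).1)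
                           ((enum_val b).2 - (enum_val a).2)| ^+ 2.
Proof.
apply/matrixP => a b; rewrite !mxE.
set k := _ - _; set l := (_ - (enum_val a).2).
pose u := wh w (enum_val a).1 (enum_val a).2 f.
pose v := wh w (enum_val b).1 (enum_val b).2 f.
transitivity (dot v u * dot u v).
  rewrite /mxtrace /dot mulr_suml; apply: eq_bigr => i _.
  rewrite !mxE mulr_sumr; apply: eq_bigr => j _.
  rewrite !mxE !big_ord1 !mxE !weyl_heisenbergE -/u -/v.
  move: (u i) (u j) (v i) (v j) => ui uj vi vj.
  by rewrite rmorphM /= conjCK; ring.
rewrite -conj_dot -normCKC /u /v (dot_wh w_prim) -/k -/l normrM.
by rewrite (norm_chi w_prim) mul1r.
Qed.

Lemma rank_gram : \rank (gram g) = #|amb_support w f|.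
Proof. by rewrite gramE (rank_amb_difference_matrix w_prim). Qed.
End GramMatrix.

Theorem theorem6 (R : realType) (d : nat) (d_prime : prime d) (d_odd : odd d) :
  ~ exists g : 'cV[R[i]]_d,
      l2norm g = 1%R /\ (d < \rank (gram g) < 2 * d)%N.
Proof.
case: d d_prime d_odd => [|[|p]] // d_prime d_odd [g [g1]].
rewrite (rank_gram d_prime d_odd).
apply: (support_gap (omega_primitive R d_prime d_odd) d_prime d_odd).
move/(congr1 (fun x => x ^+ 2)%R): g1; rewrite /l2norm sqrtCK expr1n => <-.
by apply: eq_bigr => n _; rewrite normCKC.
Qed.
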